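(* Let $\mathcal{L}_c$ be the free symmetric monoidal category with a family of locally linear endofunctors $\{E^i\mid i\in\mathcal{I}\}$ generated by a set of generating objects. Then the functor $G$ from $\mathcal{L}_c$ to the category $\mathit{Fun}$ of functions between finite ordinals is faithful; i.e. for all arrows $f,g:A\to B$ of $\mathcal{L}_c$, if $Gf=Gg$, then $f=g$ in $\mathcal{L}_c$.
   Context: A symmetric monoidal category has a bifunctor $\otimes$, a unit object $I$, and natural isomorphisms with components $a_{A,B,C}:(A\otimes B)\otimes C\to A\otimes(B\otimes C)$, $l_A:I\otimes A\to A$, $r_A:A\otimes I\to A$, $c_{A,B}:A\otimes B\to B\otimes A$, satisfying Mac Lane's coherence conditions for symmetric monoidal categories (pentagon, triangle, hexagon, $c_{B,A}\circ c_{A,B}=\mathbf{1}_{A\otimes B}$). A locally linear endofunctor of a symmetric monoidal category is an endofunctor $E$ together with natural transformations $\psi^L_{A,B}:EA\otimes B\to E(A\otimes B)$ and $\psi^R_{A,B}:A\otimes EB\to E(A\otimes B)$ such that (1) $Ea_{A,B,C}\circ\psi^L_{A\otimes B,C}\circ(\psi^L_{A,B}\otimes\mathbf{1}_C)=\psi^L_{A,B\otimes C}\circ a_{EA,B,C}$; (2) $Er_A\circ\psi^L_{A,I}=r_{EA}$; (3) $Ea_{A,B,C}\circ\psi^R_{A\otimes B,C}=\psi^R_{A,B\otimes C}\circ(\mathbf{1}_A\otimes\psi^R_{B,C})\circ a_{A,B,EC}$; (4) $El_A\circ\psi^R_{I,A}=l_{EA}$; (5) $Ea_{A,B,C}\circ\psi^L_{A\otimes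 B,C}\circ(\psi^R_{A,B}\otimes\mathbf{1}_C)=\psi^R_{A,B\otimes C}\circ(\mathbf{1}_A\otimes\psi^L_{B,C})\circ a_{A,EB,C}$; (6) $Ec_{A,B}\circ\psi^L_{A,B}=\psi^R_{B,A}\circ c_{EA,B}$. The category $\mathcal{L}_c$: fix two arbitrary sets, one of generating objects (propositional letters) and one of generating functors $\{E^i\mid i\in\mathcal{I}\}$; together these are the generators. Objects are the formulae built from the letters and the constant $I$ with the binary connective $\otimes$ and the unary connectives $E^i$. Arrows are equivalence classes of arrow terms built from $\mathbf{1}_A$, $a_{A,B,C}$, $l_A$, $r_A$, their inverses, $c_{A,B}$, and $\psi^{L,i}_{A,B}$, $\psi^{R,i}_{A,B}$ (for each $i\in\mathcal{I}$) with the operations $\circ$, $\otimes$ and $E^i$, modulo the smallest congruence for which the equations of symmetric monoidal categories hold and each $(E^i,\psi^{L,i},\psi^{R,i})$ is a locally linear endofunctor. Superscripts $i$ are omitted below. The functor $G$: $\mathit{Fun}$ has as objects the finite ordinals $n=\{0,\dots,n-1\}$ and as arrows all functions. $GA$ is the number of occurrences of generators (letters and functors $E^i$) in $A$, numbered $0,1,\dots$ from left to right. $G$ of $\mathbf{1}$, $a$, $l$, $r$ (and inverses) and of $\psi^L_{A,B}$ is an identity function; $Gc_{A,B}$ maps $k\mapsto GB+k$ for $k<GA$ and $GA+k\mapsto k$ for $k<GB$; $G\psi^R_{A,B}:GA+1+GB\to 1+GA+GB$ maps $k\mapsto 1+k$ for $k<GA$, $GA\mapsto 0$, and $GA+1+k\mapsto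 GA+1+k$ for $k<GB$; $G(f\otimes g)$ is $Gf$ and $Gg$ placed side by side (disjoint sum); $GEf$ maps $0\mapsto 0$ and $1+k\mapsto 1+(Gf)(k)$; $G(g\circ f)=Gg\circ Gf$. *)

(* Defs.v *)
From Corelib Require Import RelationClasses.
From mathcomp Require Import all_boot.

Set Implicit Arguments.
Unset Strict Implicit.
Unset Printing Implicit Defensive.

(* Categories are taken with an equivalence relation of equality on each      *)
(* hom-type, so that a category whose arrows are equivalence classes of terms *)
(* is given by the terms together with the congruence. A functor has to       *)
(* respect these equalities, i.e. to be well defined on the classes.          *)

Record category := Category {
  ob : Type;
  hom : ob -> ob -> Type;
  heq : forall A B, hom A B -> hom A B -> Prop;
  idm : forall A, hom A A;
  cmp : forall A B C, hom B C -> hom A B -> hom A C;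
  heq_equiv : forall A B, Equivalence (@heq A B);
  cmp_heq : forall A B C (g g' : hom B C) (f f' : hom A B),
    heq g g' -> heq f f' -> heq (cmp g f) (cmp g' f');
  cmp1m : forall A B (f : hom A B), heq (cmp (idm B) f) f;
  cmpm1 : forall A B (f : hom A B), heq (cmp f (idm A)) f;
  cmpA : forall A B C D (h : hom C D) (g : hom B C) (f : hom A B),
    heq (cmp (cmp h g) f) (cmp h (cmp g f))
}.

Record functor (C D : category) := Functor {
  fob : ob C -> ob D;
  fmap : forall A B, hom A B -> hom (fob A) (fob B);
  fmap_heq : forall A B (f g : hom A B), heq f g -> heq (fmap f) (fmap g);
  fmap_id : forall A, heq (fmap (idm A)) (idm (fob A));
  fmap_cmp : forall A B C (g : hom B C) (f : hom A B),
    heq (fmap (cmp g f)) (cmp (fmap g) (fmap f))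
}.

Definition faithful (C D : category) (F : functor C D) : Prop :=
  forall (A B : ob C) (f g : hom A B), heq (fmap F f) (fmap F g) -> heq f g.

Section Syntax.

Variables (Letter Idx : Type).

Inductive formula : Type :=
| Atom of Letter
| Unit
| Tensor of formula & formula
| Endo of Idx & formula.

Local Notation "A ⊗ B" := (Tensor A B) (at level 40, left associativity).
Local Notation I := Unit.

Inductive term : formula -> formula -> Type :=
| one A : term A A
| assoc A B C : term ((A ⊗ B) ⊗ C) (A ⊗ (B ⊗ C))
| assoc_inv A B C : term (A ⊗ (B ⊗ C)) ((A ⊗ B) ⊗ C)
| lunit A : term (I ⊗ A) A
| lunit_inv A : term A (I ⊗ A)
| runit A : term (A ⊗ I) A
| runit_inv A : term A (A ⊗ I)
| braid A B : term (A ⊗ B) (B ⊗ A)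
| psiL i A B : term (Endo i A ⊗ B) (Endo i (A ⊗ B))
| psiR i A B : term (A ⊗ Endo i B) (Endo i (A ⊗ B))
| compose A B C : term B C -> term A B -> term A C
| tens A B C D : term A B -> term C D -> term (A ⊗ C) (B ⊗ D)
| endo i A B : term A B -> term (Endo i A) (Endo i B).

Local Notation "g ∘ f" := (compose g f) (at level 50, left associativity).
Local Notation "f ⊠ g" := (tens f g) (at level 40, left associativity).
Reserved Notation "f ≡ g" (at level 70, no associativity).

Inductive term_eq : forall A B, term A B -> term A B -> Prop :=
| term_eq_refl A B (f : term A B) : f ≡ f
| term_eq_sym A B (f g : term A B) : f ≡ g -> g ≡ f
| term_eq_trans A B (f g h : term A B) : f ≡ g -> g ≡ h -> f ≡ h
| term_eq_comp A B C (g g' : term B C) (f f' : term A B) :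
    g ≡ g' -> f ≡ f' -> g ∘ f ≡ g' ∘ f'
| term_eq_tens A B C D (f f' : term A B) (g g' : term C D) :
    f ≡ f' -> g ≡ g' -> f ⊠ g ≡ f' ⊠ g'
| term_eq_endo i A B (f f' : term A B) : f ≡ f' -> endo i f ≡ endo i f'
| compose1m A B (f : term A B) : one B ∘ f ≡ f
| composem1 A B (f : term A B) : f ∘ one A ≡ f
| composeA A B C D (h : term C D) (g : term B C) (f : term A B) :
    (h ∘ g) ∘ f ≡ h ∘ (g ∘ f)
| tens_one A B : one A ⊠ one B ≡ one (A ⊗ B)
| tens_comp A B C A' B' C' (g : term B C) (f : term A B)
    (g' : term B' C') (f' : term A' B') :
    (g ∘ f) ⊠ (g' ∘ f') ≡ (g ⊠ g') ∘ (f ⊠ f')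
| assoc_nat A A' B B' C C' (f : term A A') (g : term B B') (h : term C C') :
    assoc A' B' C' ∘ ((f ⊠ g) ⊠ h) ≡ (f ⊠ (g ⊠ h)) ∘ assoc A B C
| assocK A B C : assoc_inv A B C ∘ assoc A B C ≡ one ((A ⊗ B) ⊗ C)
| assocVK A B C : assoc A B C ∘ assoc_inv A B C ≡ one (A ⊗ (B ⊗ C))
| lunit_nat A B (f : term A B) : lunit B ∘ (one I ⊠ f) ≡ f ∘ lunit A
| lunitK A : lunit_inv A ∘ lunit A ≡ one (I ⊗ A)
| lunitVK A : lunit A ∘ lunit_inv A ≡ one A
| runit_nat A B (f : term A B) : runit B ∘ (f ⊠ one I) ≡ f ∘ runit A
| runitK A : runit_inv A ∘ runit A ≡ one (A ⊗ I)
| runitVK A : runit A ∘ runit_inv A ≡ one A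
| braid_nat A A' B B' (f : term A A') (g : term B B') :
    braid A' B' ∘ (f ⊠ g) ≡ (g ⊠ f) ∘ braid A B
| braidK A B : braid B A ∘ braid A B ≡ one (A ⊗ B)
| pentagon A B C D :
    assoc A B (C ⊗ D) ∘ assoc (A ⊗ B) C D
    ≡ (one A ⊠ assoc B C D) ∘ assoc A (B ⊗ C) D ∘ (assoc A B C ⊠ one D)
| triangle A B : (one A ⊠ lunit B) ∘ assoc A I B ≡ runit A ⊠ one B
| hexagon A B C :
    assoc B C A ∘ braid A (B ⊗ C) ∘ assoc A B C
    ≡ (one B ⊠ braid A C) ∘ assoc B A C ∘ (braid A B ⊠ one C)
| endo_one i A : endo i (one A) ≡ one (Endo i A)
| endo_comp i A B C (g : term B C) (f : term A B) :
    endo i (g ∘ f) ≡ endo i g ∘ endo i f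
| psiL_nat i A A' B B' (f : term A A') (g : term B B') :
    psiL i A' B' ∘ (endo i f ⊠ g) ≡ endo i (f ⊠ g) ∘ psiL i A B
| psiR_nat i A A' B B' (f : term A A') (g : term B B') :
    psiR i A' B' ∘ (f ⊠ endo i g) ≡ endo i (f ⊠ g) ∘ psiR i A B
| psiL_assoc i A B C :
    endo i (assoc A B C) ∘ psiL i (A ⊗ B) C ∘ (psiL i A B ⊠ one C)
    ≡ psiL i A (B ⊗ C) ∘ assoc (Endo i A) B C
| psiL_runit i A : endo i (runit A) ∘ psiL i A I ≡ runit (Endo i A)
| psiR_assoc i A B C :
    endo i (assoc A B C) ∘ psiR i (A ⊗ B) C
    ≡ psiR i A (B ⊗ C) ∘ (one A ⊠ psiR i B C) ∘ assoc A B (Endo i C)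
| psiR_lunit i A : endo i (lunit A) ∘ psiR i I A ≡ lunit (Endo i A)
| psiLR_assoc i A B C :
    endo i (assoc A B C) ∘ psiL i (A ⊗ B) C ∘ (psiR i A B ⊠ one C)
    ≡ psiR i A (B ⊗ C) ∘ (one A ⊠ psiL i B C) ∘ assoc A (Endo i B) C
| psi_braid i A B :
    endo i (braid A B) ∘ psiL i A B ≡ psiR i B A ∘ braid (Endo i A) B
where "f ≡ g" := (term_eq f g).

Lemma term_eq_equiv A B : Equivalence (@term_eq A B).
Proof. split; [exact: term_eq_refl | exact: term_eq_sym | exact: term_eq_trans]. Qed.

Definition Lc : category := Category term_eq_equiv term_eq_comp compose1m composem1 composeA.

End Syntax.

Definition fun_cmp (m n p : nat) (g : {ffun 'I_n -> 'I_p})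
  (f : {ffun 'I_m -> 'I_n}) : {ffun 'I_m -> 'I_p} := [ffun k => g (f k)].

Definition fun_id (n : nat) : {ffun 'I_n -> 'I_n} := [ffun k => k].

(* The identity function, read as an arrow between propositionally equal      *)
(* ordinals.                                                                  *)
Definition fun_cast (m n : nat) (e : m = n) : {ffun 'I_m -> 'I_n} :=
  [ffun k => cast_ord e k].

Definition fun_sum (m n p q : nat) (f : {ffun 'I_m -> 'I_n})
  (g : {ffun 'I_p -> 'I_q}) : {ffun 'I_(m + p) -> 'I_(n + q)} :=
  [ffun k => match split k with
             | inl i => lshift q (f i)
             | inr j => rshift n (g j)
             end].

Definition fun_swap (m n : nat) : {ffun 'I_(m + n) -> 'I_(n + m)} :=
  [ffun k => match split k with
             | inl i => rshift n i
             | inr j => lshift m j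
             end].

Definition fun_psiR (m n : nat) : {ffun 'I_(m + (1 + n)) -> 'I_(1 + (m + n))} :=
  [ffun k => match split k with
             | inl i => rshift 1 (lshift n i)
             | inr j => match split j with
                        | inl z => lshift (m + n) z
                        | inr j' => rshift 1 (rshift m j')
                        end
             end].

Lemma fun_cmp1m m n (f : {ffun 'I_m -> 'I_n}) : fun_cmp (fun_id n) f = f.
Proof. by apply/ffunP => k; rewrite !ffunE. Qed.

Lemma fun_cmpm1 m n (f : {ffun 'I_m -> 'I_n}) : fun_cmp f (fun_id m) = f.
Proof. by apply/ffunP => k; rewrite !ffunE. Qed.

Lemma fun_cmpA m n p q (h : {ffun 'I_p -> 'I_q}) (g : {ffun 'I_n -> 'I_p})
  (f : {ffun 'I_m -> 'I_n}) :
  fun_cmp (fun_cmp h g) f = fun_cmp h (fun_cmp g f).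
Proof. by apply/ffunP => k; rewrite !ffunE. Qed.

Lemma fun_cmp_eq m n p (g g' : {ffun 'I_n -> 'I_p}) (f f' : {ffun 'I_m -> 'I_n}) :
  g = g' -> f = f' -> fun_cmp g f = fun_cmp g' f'.
Proof. by move=> -> ->. Qed.

Lemma fun_sumL m n p q (f : {ffun 'I_m -> 'I_n}) (g : {ffun 'I_p -> 'I_q}) i :
  fun_sum f g (lshift p i) = lshift q (f i).
Proof. by rewrite ffunE (unsplitK (inl i)). Qed.

Lemma fun_sumR m n p q (f : {ffun 'I_m -> 'I_n}) (g : {ffun 'I_p -> 'I_q}) i :
  fun_sum f g (rshift m i) = rshift n (g i).
Proof. by rewrite ffunE (unsplitK (inr i)). Qed.

Lemma fun_swapL m n i : fun_swap m n (lshift n i) = rshift n i.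
Proof. by rewrite ffunE (unsplitK (inl i)). Qed.

Lemma fun_swapR m n i : fun_swap m n (rshift m i) = lshift m i.
Proof. by rewrite ffunE (unsplitK (inr i)). Qed.

Lemma fun_psiRL m n i : fun_psiR m n (lshift (1 + n) i) = rshift 1 (lshift n i).
Proof. by rewrite ffunE (unsplitK (inl i)). Qed.

Lemma fun_psiRM m n z : fun_psiR m n (rshift m (lshift n z)) = lshift (m + n) z.
Proof. by rewrite ffunE (unsplitK (inr _)) (unsplitK (inl _)). Qed.

Lemma fun_psiRR m n j :
  fun_psiR m n (rshift m (rshift 1 j)) = rshift 1 (rshift m j).
Proof. by rewrite ffunE (unsplitK (inr _)) (unsplitK (inr _)). Qed.

Lemma fun_castAL m n p (e : m + n + p = m + (n + p)) i :
  fun_cast e (lshift p (lshift n i)) = lshift (n + p) i.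
Proof. by rewrite ffunE; apply: val_inj. Qed.

Lemma fun_castAM m n p (e : m + n + p = m + (n + p)) i :
  fun_cast e (lshift p (rshift m i)) = rshift m (lshift p i).
Proof. by rewrite ffunE; apply: val_inj. Qed.

Lemma fun_castAR m n p (e : m + n + p = m + (n + p)) i :
  fun_cast e (rshift (m + n) i) = rshift m (rshift n i).
Proof. by rewrite ffunE; apply: val_inj => /=; rewrite addnA. Qed.

Lemma fun_cast0l m (e : 0 + m = m) i : fun_cast e (rshift 0 i) = i.
Proof. by rewrite ffunE; apply: val_inj. Qed.

Lemma fun_cast0r m (e : m + 0 = m) i : fun_cast e (lshift 0 i) = i.
Proof. by rewrite ffunE; apply: val_inj. Qed.

Lemma fun_cmpE m n p (g : {ffun 'I_n -> 'I_p}) (f : {ffun 'I_m -> 'I_n}) k :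
  fun_cmp g f k = g (f k).
Proof. by rewrite ffunE. Qed.

Lemma fun_idE n k : fun_id n k = k.
Proof. by rewrite ffunE. Qed.

Definition funE := (fun_cmpE, fun_idE, fun_sumL, fun_sumR, fun_swapL, fun_swapR,
  fun_psiRL, fun_psiRM, fun_psiRR, fun_castAL, fun_castAM, fun_castAR,
  fun_cast0l, fun_cast0r).

Lemma fun_castK m n (e : m = n) (e' : n = m) :
  fun_cmp (fun_cast e') (fun_cast e) = fun_id m.
Proof. by apply/ffunP => k; rewrite !ffunE; apply: val_inj. Qed.

Definition Fun : category :=
  @Category nat (fun m n => {ffun 'I_m -> 'I_n}) (fun _ _ => eq) fun_id fun_cmp
    (fun _ _ => eq_equivalence) fun_cmp_eq fun_cmp1m fun_cmpm1 fun_cmpA.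

Section Interpretation.

Variables (Letter Idx : Type).
Local Notation formula := (formula Letter Idx).

(* Gob A is the number of occurrences of letters and of endofunctors in A,     *)
(* numbered from left to right; the Endo i heading Endo i A comes before the   *)
(* occurrences in A.                                                           *)
Fixpoint Gob (A : formula) : nat :=
  match A with
  | Atom _ => 1
  | Unit => 0
  | Tensor A B => Gob A + Gob B
  | Endo _ A => 1 + Gob A
  end.

Fixpoint Gterm (A B : formula) (f : term A B) : {ffun 'I_(Gob A) -> 'I_(Gob B)} :=
  match f with
  | one A => fun_id (Gob A)
  | assoc A B C => fun_cast (esym (addnA (Gob A) (Gob B) (Gob C)))
  | assoc_inv A B C => fun_cast (addnA (Gob A) (Gob B) (Gob C))
  | lunit A => fun_cast (add0n (Gob A))
  | lunit_inv A => fun_cast (esym (add0n (Gob A)))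
  | runit A => fun_cast (addn0 (Gob A))
  | runit_inv A => fun_cast (esym (addn0 (Gob A)))
  | braid A B => fun_swap (Gob A) (Gob B)
  | psiL _ A B => fun_cast (esym (addnA 1 (Gob A) (Gob B)))
  | psiR _ A B => fun_psiR (Gob A) (Gob B)
  | compose _ _ _ g f => fun_cmp (Gterm g) (Gterm f)
  | tens _ _ _ _ f g => fun_sum (Gterm f) (Gterm g)
  | endo _ _ _ f => fun_sum (fun_id 1) (Gterm f)
  end.

Lemma Gterm_eq A B (f g : term A B) : term_eq f g -> Gterm f = Gterm g.
Proof.
elim=> {A B f g} /=; intros; rewrite ?fun_castK //; try congruence.
all: apply/ffunP => k.
all: do ?[rewrite !funE | done | case: (split_ordP k) => {}k -> | case: k => [] //].
Qed.

Definition G : functor (Lc Letter Idx) Fun :=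
  @Functor (Lc Letter Idx) Fun Gob Gterm Gterm_eq
    (fun A => erefl) (fun A B C g f => erefl).

End Interpretation.

(* Main.v *)
From Corelib Require Import Setoid Morphisms.
From Stdlib Require Import Eqdep.
From mathcomp Require Import all_boot zify.
Require Import Defs.

(** Read an object as a forest: its nodes are the generators, the tensor puts
    forests side by side, and [Endo i A] is a tree with root [i] above the
    forest [A]. An arrow moves trees, possibly under the root of a neighbouring
    tree, and never takes a node out from under a root. Hence, for [f : A -> C],
    what lies at the top of [C] already lies at the top of [A], and [f] can be
    rewritten so that it first rearranges the top of [A] to match the top of [C]
    and then works inside the pieces. The rearrangement is dictated by [G f] and
    the rest is handled by induction on [C]. There are three shapes of target.

    - [C] is [I], or more generally a tensor of copies of [I]: any two arrows
      into it are equal ([unital_unique]).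
    - [C] is [Endo i D]: the root [i] of [C] comes from a root of [A], and [f] is
      the canonical arrow [pull] that moves everything in [A] under that root,
      followed by [Endo i] of an arrow into [D] ([pull_nat], [pull_unique]).
      A letter [x] is treated in the same way: tensoring with [x] on the left is
      also a locally linear endofunctor, and [x] is this functor applied to [I].
    - [C] is [X ⊗ Y]: every top-level tree of [A] goes either to [X] or to [Y],
      so that [f] separates the trees into two groups by a symmetric monoidal
      isomorphism [cutm] and then is a tensor of two arrows ([cutm_nat],
      [tens_unique]).

    Both factorizations come from a naturality property, proved by induction on
    the arrow term: the canonical arrow out of the target, precomposed with [f],
    is a canonical arrow out of the source followed by an arrow between the
    pieces. Each defining equation of a locally linear endofunctor is one case
    of the naturality of [pull].

    The naturality of [cutm] needs equations between the exchange maps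
    [(A ⊗ B) ⊗ (C ⊗ D) -> (A ⊗ C) ⊗ (B ⊗ D)]. They are instances of the
    coherence of symmetric monoidal categories, which is the theorem without
    endofunctors and has an easier proof: then [pull] is split mono, so pulling
    out one letter after another suffices ([smc_faithful]). *)

Set Implicit Arguments.
Unset Strict Implicit.
Unset Printing Implicit Defensive.

Arguments Unit {Letter Idx}.

Local Notation "A ⊗ B" := (Tensor A B) (at level 40, left associativity).
Local Notation I := Unit.
Local Notation "g ∘ f" := (compose g f) (at level 50, left associativity).
Local Notation "f ⊠ g" := (tens f g) (at level 40, left associativity).
Local Notation "f ≡ g" := (term_eq f g) (at level 70, no associativity).
Local Notation one := Defs.one.

#[local] Existing Instance term_eq_equiv.

#[local] Instance compose_proper (L J : Type) (A B C : formula L J) :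
  Proper (@term_eq L J B C ==> @term_eq L J A B ==> @term_eq L J A C)
         (@compose L J A B C).
Proof. by move=> g g' eg f f'; apply: term_eq_comp. Qed.

#[local] Instance tens_proper (L J : Type) (A B C D : formula L J) :
  Proper (@term_eq L J A B ==> @term_eq L J C D ==> @term_eq L J (A ⊗ C) (B ⊗ D))
         (@tens L J A B C D).
Proof. by move=> f f' ef g g'; apply: term_eq_tens. Qed.

#[local] Instance endo_proper (L J : Type) (i : J) (A B : formula L J) :
  Proper (@term_eq L J A B ==> @term_eq L J (Endo i A) (Endo i B)) (@endo L J i A B).
Proof. by move=> f f'; apply: term_eq_endo. Qed.

#[local] Hint Extern 0 (term_eq _ _) => reflexivity : core.

(** * Consequences of the symmetric monoidal axioms *)

Section Coherence.

Variables Letter Idx : Type.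
Local Notation formula := (formula Letter Idx).
Implicit Types A B C D X Y : formula.

(** Composites are kept associated to the right; this and the next two lemmas
    let an equation between composites act on a prefix of a longer one. *)
Lemma comp_eq_comp1 A B C D (g : term B C) (f : term A B) h (k : term D A) :
  g ∘ f ≡ h -> g ∘ (f ∘ k) ≡ h ∘ k.
Proof. by move=> <-; rewrite composeA. Qed.

Lemma comp_eq_comp2 A B B' C D (g : term B C) (f : term A B)
    (g' : term B' C) (f' : term A B') (k : term D A) :
  g ∘ f ≡ g' ∘ f' -> g ∘ (f ∘ k) ≡ g' ∘ (f' ∘ k).
Proof. by move=> e; rewrite (comp_eq_comp1 _ e) composeA. Qed.

Lemma comp_cancel A B D (g : term B A) (f : term A B) (k : term D A) :
  g ∘ f ≡ one A -> g ∘ (f ∘ k) ≡ k.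
Proof. by move=> e; rewrite (comp_eq_comp1 _ e) compose1m. Qed.

Lemma split_epi_cancel A B C (g g' : term B C) (f : term A B) (f' : term B A) :
  f ∘ f' ≡ one B -> g ∘ f ≡ g' ∘ f -> g ≡ g'.
Proof. by move=> e eq; rewrite -(composem1 g) -(composem1 g') -e -!composeA eq. Qed.

Lemma split_mono_cancel A B C (g : term B C) (g' : term C B) (f f' : term A B) :
  g' ∘ g ≡ one B -> g ∘ f ≡ g ∘ f' -> f ≡ f'.
Proof. by move=> e eq; rewrite -(compose1m f) -(compose1m f') -e !composeA eq. Qed.

Lemma tens_compL A B C D (g : term B C) (f : term A B) :
  (g ⊠ one D) ∘ (f ⊠ one D) ≡ (g ∘ f) ⊠ one D.
Proof. by rewrite -tens_comp compose1m. Qed.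

Lemma tens_compR A B C D (g : term B C) (f : term A B) :
  (one D ⊠ g) ∘ (one D ⊠ f) ≡ one D ⊠ (g ∘ f).
Proof. by rewrite -tens_comp compose1m. Qed.

Lemma runit_faithful A B (f g : term A B) : f ⊠ one I ≡ g ⊠ one I -> f ≡ g.
Proof.
move=> e; apply: (split_epi_cancel (runitVK _)).
by rewrite -!runit_nat e.
Qed.

Lemma lunit_faithful A B (f g : term A B) : one I ⊠ f ≡ one I ⊠ g -> f ≡ g.
Proof.
move=> e; apply: (split_epi_cancel (lunitVK _)).
by rewrite -!lunit_nat e.
Qed.

(** Kelly's redundancy argument: [I ⊗ -] is faithful, and after tensoring with
    [I] the claim follows from the pentagon for [I, I, A, B] and two triangles. *)
Lemma lunit_tens A B : lunit (A ⊗ B) ∘ assoc I A B ≡ lunit A ⊠ one B.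
Proof.
apply: lunit_faithful.
have e : (assoc I (I ⊗ A) B ∘ (assoc I I A ⊠ one B)) ∘
   ((assoc_inv I I A ⊠ one B) ∘ assoc_inv I (I ⊗ A) B) ≡ one _.
  rewrite composeA (comp_cancel _ (g := _ ⊠ _)); first exact: assocVK.
  by rewrite tens_compL assocVK tens_one.
apply: (split_epi_cancel e).
have p := pentagon I I A B; rewrite composeA in p.
rewrite -tens_compR composeA -p -composeA triangle -tens_one -(assoc_nat (runit I)).
by rewrite -triangle -tens_compL -[X in _ ≡ X]composeA -assoc_nat composeA.
Qed.

(** The mirror image: tensor with [I] on the right and use the pentagon for
    [A, B, I, I]. *)
Lemma runit_tens A B : (one A ⊠ runit B) ∘ assoc A B I ≡ runit (A ⊗ B).
Proof.
apply: runit_faithful.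
apply: (split_mono_cancel (assocK _ _ _)).
rewrite -(triangle (A ⊗ B)) -composeA -tens_one assoc_nat composeA.
rewrite -tens_compL -composeA assoc_nat -triangle.
rewrite -tens_compR !composeA.
by have p := pentagon A B I I; rewrite composeA in p; rewrite p.
Qed.

(** [lunit (I ⊗ I)] is [one I ⊠ lunit I] by naturality, so the triangle compares
    [runit I ⊠ one I] with [lunit I ⊠ one I]. *)
Lemma lunit_runit_unit : lunit (I : formula) ≡ runit I.
Proof.
apply: runit_faithful.
have e : lunit (I ⊗ I) ≡ one I ⊠ lunit (I : formula).
  by apply: (split_mono_cancel (lunitK I)); rewrite lunit_nat.
by rewrite -lunit_tens -triangle e.
Qed.

(** The hexagon for [A, I, I], followed by a left unit. *)
Lemma lunit_braid A : lunit A ∘ braid A I ≡ runit A.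
Proof.
apply: runit_faithful.
apply: (split_mono_cancel (braidK _ _)).
rewrite -tens_compL -lunit_tens !composeA -(composeA (braid A I)).
have h := hexagon A I I; rewrite !composeA in h.
rewrite -lunit_nat !composeA -h -(composeA (lunit _)) lunit_tens.
by rewrite -composeA -braid_nat composeA triangle.
Qed.

Lemma runit_braid A : runit A ∘ braid I A ≡ lunit A.
Proof. by rewrite -lunit_braid composeA braidK composem1. Qed.

(** With [assoc] as the left strength, [shuffle] is the right strength that makes
    [X ⊗ -] a locally linear endofunctor. It is locked because rewriting with
    the associativity of composition would otherwise reach inside it. *)
Definition shuffle A X B : term (A ⊗ (X ⊗ B)) (X ⊗ (A ⊗ B)) :=
  locked (assoc X A B ∘ (braid A X ⊠ one B) ∘ assoc_inv A X B).

Lemma shuffleE A X B :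
  shuffle A X B = assoc X A B ∘ (braid A X ⊠ one B) ∘ assoc_inv A X B.
Proof. by rewrite /shuffle -lock. Qed.

Lemma assoc_inv_nat A A' B B' C C' (f : term A A') (g : term B B') (h : term C C') :
  assoc_inv A' B' C' ∘ (f ⊠ (g ⊠ h)) ≡ ((f ⊠ g) ⊠ h) ∘ assoc_inv A B C.
Proof.
apply: (split_mono_cancel (assocK _ _ _)); rewrite -!composeA assocVK compose1m.
by rewrite assoc_nat composeA assocVK composem1.
Qed.

Lemma shuffle_nat A A' X X' B B' (f : term A A') (h : term X X') (g : term B B') :
  shuffle A' X' B' ∘ (f ⊠ (h ⊠ g)) ≡ (h ⊠ (f ⊠ g)) ∘ shuffle A X B.
Proof.
rewrite (shuffleE A') !composeA assoc_inv_nat -(composeA (_ ⊠ one _)) -tens_comp.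
rewrite braid_nat compose1m -(composem1 g) tens_comp composem1.
by rewrite -!(composeA (assoc _ _ _)) assoc_nat shuffleE !composeA.
Qed.

Lemma shuffle_lunit X A : (one X ⊠ lunit A) ∘ shuffle I X A ≡ lunit (X ⊗ A).
Proof.
rewrite shuffleE -!composeA triangle tens_compL runit_braid -lunit_tens.
by rewrite composeA assocVK composem1.
Qed.

(** This is the hexagon for [B, X, A]. *)
Lemma shuffle_braid X A B :
  (one X ⊠ braid A B) ∘ assoc X A B ≡ shuffle B X A ∘ braid (X ⊗ A) B.
Proof.
apply: (split_mono_cancel (g := one X ⊠ braid B A) (g' := one X ⊠ braid A B)).
  by rewrite tens_compR braidK tens_one.
rewrite -!composeA tens_compR braidK tens_one compose1m shuffleE.
rewrite -!composeA -(hexagon B X A).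
by rewrite !composeA (comp_cancel _ (assocVK _ _ _)) braidK composem1.
Qed.

(** Two pentagons, for [X, A, B, C] and for [A, X, B, C], joined by the naturality
    of the associativity. *)
Lemma assoc_shuffle X A B C :
  (one X ⊠ assoc A B C) ∘ assoc X (A ⊗ B) C ∘ (shuffle A X B ⊠ one C)
  ≡ shuffle A X (B ⊗ C) ∘ (one A ⊠ assoc X B C) ∘ assoc A (X ⊗ B) C.
Proof.
apply: (split_epi_cancel (f := assoc A X B ⊠ one C) (f' := assoc_inv A X B ⊠ one C)).
  by rewrite tens_compL assocVK tens_one.
rewrite shuffleE -!tens_compL.
have q := pentagon A X B C; rewrite composeA in q.
have e' : (assoc_inv A X B ⊠ one C) ∘ (assoc A X B ⊠ one C) ≡ one _.
  by rewrite tens_compL assocK tens_one.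
rewrite -!composeA -pentagon !composeA e' composem1 -q shuffleE.
rewrite !composeA (comp_cancel _ (assocK _ _ _)).
by rewrite assoc_nat tens_one.
Qed.

(** The hexagon for [X, A, B], with all arrows inverted. *)
Lemma braid_tens X A B :
  braid (A ⊗ B) X ≡ shuffle A X B ∘ (one A ⊠ braid B X) ∘ assoc A B X.
Proof.
apply: (split_mono_cancel (braidK _ _)); rewrite braidK.
have h := hexagon X A B.
have {}h : braid X (A ⊗ B) ≡ assoc_inv A B X ∘ ((one A ⊠ braid X B)
   ∘ assoc A X B ∘ (braid X A ⊠ one B)) ∘ assoc_inv X A B.
  rewrite -h -!composeA assocK compose1m composeA assocVK.
  by rewrite composem1.
rewrite h shuffleE !composeA (comp_cancel _ (assocK _ _ _)).
rewrite -(composeA (braid X A ⊠ _)) tens_compL braidK tens_one compose1m.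
rewrite (comp_cancel _ (assocVK _ _ _)) -(composeA (one A ⊠ _)) tens_compR braidK.
by rewrite tens_one compose1m assocK.
Qed.

(** Expanding the braiding of [A ⊗ B] past [X] by [braid_tens] reduces this to
    [assoc_shuffle] and the pentagon for [A, B, X, C]. *)
Lemma shuffle_assoc X A B C :
  (one X ⊠ assoc A B C) ∘ shuffle (A ⊗ B) X C
  ≡ shuffle A X (B ⊗ C) ∘ (one A ⊠ shuffle B X C) ∘ assoc A B (X ⊗ C).
Proof.
have e : braid (A ⊗ B) X ⊠ one C ≡ (shuffle A X B ⊠ one C)
    ∘ (((one A ⊠ braid B X) ⊠ one C) ∘ (assoc A B X ⊠ one C)).
  by rewrite !tens_compL braid_tens composeA.
rewrite (shuffleE (A ⊗ B)) e -!composeA assoc_shuffle !composeA.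
apply: term_eq_comp => //; rewrite shuffleE -!tens_compR !composeA.
apply: term_eq_comp => //; rewrite (comp_eq_comp2 _ (assoc_nat _ _ _)).
apply: term_eq_comp => //.
apply: (split_mono_cancel (g := one A ⊠ assoc B X C) (g' := one A ⊠ assoc_inv B X C)).
  by rewrite tens_compR assocK tens_one.
rewrite -!composeA -pentagon tens_compR assocVK tens_one compose1m.
by rewrite !composeA assocVK composem1.
Qed.

End Coherence.

(** * Pulling a top-level generator to the front *)

Section Roots.

Variables Letter Idx : Type.
Local Notation formula := (formula Letter Idx).
Implicit Types A B C D X Y : formula.

Definition generator : Type := Letter + Idx.
Implicit Type o : generator.

(** Each generator acts as a locally linear endofunctor with strengths [tauL] and
    [tauR]: an index as the given endofunctor, a letter by tensoring with it on
    the left. The two kinds of generators can then be treated at once. *)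
Definition wrap o A : formula :=
  match o with inl x => Atom Idx x ⊗ A | inr i => Endo i A end.

Definition wrapm o A B (f : term A B) : term (wrap o A) (wrap o B) :=
  match o with inl x => one (Atom Idx x) ⊠ f | inr i => endo i f end.

Definition tauL o A B : term (wrap o A ⊗ B) (wrap o (A ⊗ B)) :=
  match o with inl x => assoc (Atom Idx x) A B | inr i => psiL i A B end.

Definition tauR o A B : term (A ⊗ wrap o B) (wrap o (A ⊗ B)) :=
  match o with inl x => shuffle A (Atom Idx x) B | inr i => psiR i A B end.

#[local] Instance wrapm_proper o A B :
  Proper (@term_eq _ _ A B ==> @term_eq _ _ (wrap o A) (wrap o B)) (@wrapm o A B).
Proof. by case: o => [x|i] f f' ef /=; rewrite ef. Qed.

Lemma wrapm_one o A : wrapm o (one A) ≡ one (wrap o A).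
Proof. by case: o => [x|i] /=; [exact: tens_one | exact: endo_one]. Qed.

Lemma wrapm_comp o A B C (g : term B C) (f : term A B) :
  wrapm o (g ∘ f) ≡ wrapm o g ∘ wrapm o f.
Proof. by case: o => [x|i] /=; rewrite ?tens_compR ?endo_comp. Qed.

Lemma tauL_nat o A A' B B' (f : term A A') (g : term B B') :
  tauL o A' B' ∘ (wrapm o f ⊠ g) ≡ wrapm o (f ⊠ g) ∘ tauL o A B.
Proof. by case: o => [x|i]; [exact: assoc_nat | exact: psiL_nat]. Qed.

Lemma tauR_nat o A A' B B' (f : term A A') (g : term B B') :
  tauR o A' B' ∘ (f ⊠ wrapm o g) ≡ wrapm o (f ⊠ g) ∘ tauR o A B.
Proof. by case: o => [x|i]; [exact: shuffle_nat | exact: psiR_nat]. Qed.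

Lemma tauL_assoc o A B C :
  wrapm o (assoc A B C) ∘ tauL o (A ⊗ B) C ∘ (tauL o A B ⊠ one C)
  ≡ tauL o A (B ⊗ C) ∘ assoc (wrap o A) B C.
Proof.
case: o => [x|i]; last exact: psiL_assoc.
by symmetry; exact: pentagon.
Qed.

Lemma tauL_runit o A : wrapm o (runit A) ∘ tauL o A I ≡ runit (wrap o A).
Proof. by case: o => [x|i]; [exact: runit_tens | exact: psiL_runit]. Qed.

Lemma tauR_assoc o A B C :
  wrapm o (assoc A B C) ∘ tauR o (A ⊗ B) C
  ≡ tauR o A (B ⊗ C) ∘ (one A ⊠ tauR o B C) ∘ assoc A B (wrap o C).
Proof. by case: o => [x|i]; [exact: shuffle_assoc | exact: psiR_assoc]. Qed.

Lemma tauR_lunit o A : wrapm o (lunit A) ∘ tauR o I A ≡ lunit (wrap o A).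
Proof. by case: o => [x|i]; [exact: shuffle_lunit | exact: psiR_lunit]. Qed.

Lemma tauLR_assoc o A B C :
  wrapm o (assoc A B C) ∘ tauL o (A ⊗ B) C ∘ (tauR o A B ⊠ one C)
  ≡ tauR o A (B ⊗ C) ∘ (one A ⊠ tauL o B C) ∘ assoc A (wrap o B) C.
Proof. by case: o => [x|i]; [exact: assoc_shuffle | exact: psiLR_assoc]. Qed.

Lemma tau_braid o A B :
  wrapm o (braid A B) ∘ tauL o A B ≡ tauR o B A ∘ braid (wrap o A) B.
Proof. by case: o => [x|i]; [exact: shuffle_braid | exact: psi_braid]. Qed.

Lemma tau_braid_sym o A B :
  wrapm o (braid A B) ∘ tauR o A B ≡ tauL o B A ∘ braid A (wrap o B).
Proof.
apply: (split_mono_cancel (g := wrapm o (braid B A)) (g' := wrapm o (braid A B))).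
  by rewrite -wrapm_comp braidK wrapm_one.
rewrite -!composeA -wrapm_comp braidK wrapm_one compose1m tau_braid.
by rewrite composeA braidK composem1.
Qed.

(** The occurrences of generators that are not under an endofunctor. *)
Fixpoint root A : Type :=
  match A with
  | Atom _ => unit
  | Unit => void
  | A ⊗ B => root A + root B
  | Endo _ _ => unit
  end.

Fixpoint label A : root A -> generator :=
  match A with
  | Atom x => fun _ => inl x
  | Unit => fun p => match p with end
  | A ⊗ B => fun p => match p with inl p => label p | inr p => label p end
  | Endo i _ => fun _ => inr i
  end.

(** Removing a letter leaves [I] in its place, removing an endofunctor leaves its
    argument. *)
Fixpoint rest A : root A -> formula :=
  match A with
  | Atom x => fun _ => I
  | Unit => fun _ => I
  | A ⊗ B => fun p => match p with inl p => rest p ⊗ B | inr p => A ⊗ rest p end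
  | Endo i A => fun _ => A
  end.

Fixpoint pull A : forall p : root A, term A (wrap (label p) (rest p)) :=
  match A with
  | Atom x => fun _ => runit_inv (Atom Idx x)
  | Unit => fun p => match p with end
  | A ⊗ B => fun p => match p with
                      | inl p => tauL (label p) (rest p) B ∘ (pull p ⊠ one B)
                      | inr p => tauR (label p) A (rest p) ∘ (one A ⊠ pull p)
                      end
  | Endo i A => fun _ => one (Endo i A)
  end.

(** [factors f] says that the generator at the head of the target comes from a
    root [p] of the source, and that [f] is [pull p] followed by an arrow under
    that generator. The generator [o] is an index of the family rather than an
    equation, so that the closure properties need no transport. *)
Variant factors A : forall o B, term A (wrap o B) -> Prop :=
  Factors (p : root A) B (k : term (rest p) B) f :
    f ≡ wrapm (label p) k ∘ pull p -> @factors A (label p) B f.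

Lemma factors_eq A o B (f g : term A (wrap o B)) : f ≡ g -> factors f -> factors g.
Proof. by move=> e h; case: h g e => p {}B k {}f h g e; apply: (Factors (k := k)); rewrite -e. Qed.

Lemma factors_pull A (p : root A) : factors (pull p).
Proof. by apply: (Factors (k := one _)); rewrite wrapm_one compose1m. Qed.

Lemma factors_wrap A o B C (h : term B C) (f : term A (wrap o B)) :
  factors f -> factors (wrapm o h ∘ f).
Proof.
move=> hf; case: hf h => p {}B k {}f e h.
by apply: (Factors (k := h ∘ k)); rewrite e -composeA wrapm_comp.
Qed.

Lemma factors_comp A B o C (h : term B (wrap o C)) (f : term A B) :
  factors h -> (forall q : root B, factors (pull q ∘ f)) -> factors (h ∘ f).
Proof.
move=> hh hf; case: hh => q {}C k {}h e.
apply: (@factors_eq _ _ _ (wrapm (label q) k ∘ (pull q ∘ f))).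
  by rewrite e composeA.
exact/factors_wrap/hf.
Qed.

Lemma factors_tauL A o B C D (h : term A (wrap o B)) (g : term C D) :
  factors h -> factors (tauL o B D ∘ (h ⊠ g)).
Proof.
case=> p {}B k {}h e; apply: (@Factors (A ⊗ C) (inl p) _ (k ⊠ g)) => /=.
by rewrite e -composeA -tauL_nat [X in _ ≡ X]composeA -tens_comp composem1.
Qed.

Lemma factors_tauR A o B C D (h : term A (wrap o B)) (g : term C D) :
  factors h -> factors (tauR o D B ∘ (g ⊠ h)).
Proof.
case=> p {}B k {}h e; apply: (@Factors (C ⊗ A) (inr p) _ (g ⊠ k)) => /=.
by rewrite e -composeA -tauR_nat [X in _ ≡ X]composeA -tens_comp composem1.
Qed.

(** The next lemmas say that the structural isomorphisms commute with pulling, in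
    the direction of the axioms of locally linear endofunctors; [factors_inv]
    turns them around for the inverse isomorphisms. *)
Lemma pull_assocL A B C (p : root A) :
  wrapm (label p) (assoc _ B C) ∘ pull (inl (inl p) : root (A ⊗ B ⊗ C))
  ≡ pull (inl p : root (A ⊗ (B ⊗ C))) ∘ assoc A B C.
Proof.
rewrite /= -tens_compL -!composeA tauL_assoc !composeA.
by rewrite assoc_nat tens_one.
Qed.

Lemma pull_assocM A B C (p : root B) :
  wrapm (label p) (assoc A _ C) ∘ pull (inl (inr p) : root (A ⊗ B ⊗ C))
  ≡ pull (inr (inl p) : root (A ⊗ (B ⊗ C))) ∘ assoc A B C.
Proof.
rewrite /= -tens_compL -!composeA tauLR_assoc -tens_compR !composeA.
by rewrite assoc_nat.
Qed.

Lemma pull_assocR A B C (p : root C) :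
  wrapm (label p) (assoc A B _) ∘ pull (inr p : root (A ⊗ B ⊗ C))
  ≡ pull (inr (inr p) : root (A ⊗ (B ⊗ C))) ∘ assoc A B C.
Proof.
rewrite /= -!composeA tauR_assoc -tens_compR -tens_one !composeA.
by rewrite assoc_nat.
Qed.

Lemma pull_lunit A (p : root A) :
  wrapm (label p) (lunit _) ∘ pull (inr p : root (I ⊗ A)) ≡ pull p ∘ lunit A.
Proof. by rewrite /= -composeA tauR_lunit lunit_nat. Qed.

Lemma pull_runit A (p : root A) :
  wrapm (label p) (runit _) ∘ pull (inl p : root (A ⊗ I)) ≡ pull p ∘ runit A.
Proof. by rewrite /= -composeA tauL_runit runit_nat. Qed.

Lemma pull_braidL A B (p : root A) :
  wrapm (label p) (braid _ B) ∘ pull (inl p : root (A ⊗ B))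
  ≡ pull (inr p : root (B ⊗ A)) ∘ braid A B.
Proof. by rewrite /= -composeA tau_braid !composeA braid_nat. Qed.

Lemma pull_braidR A B (p : root B) :
  wrapm (label p) (braid A _) ∘ pull (inr p : root (A ⊗ B))
  ≡ pull (inl p : root (B ⊗ A)) ∘ braid A B.
Proof. by rewrite /= -composeA tau_braid_sym !composeA braid_nat. Qed.

Lemma factors_inv A B o X Y (s : term A B) (s' : term B A)
    (t : term X Y) (t' : term Y X) (f : term A (wrap o X)) (g : term B (wrap o Y)) :
  s ∘ s' ≡ one B -> t' ∘ t ≡ one X -> wrapm o t ∘ f ≡ g ∘ s ->
  factors g -> factors (f ∘ s').
Proof.
move=> es et e hg; apply: (@factors_eq _ _ _ (wrapm o t' ∘ g)); last exact: factors_wrap.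
by rewrite -(composem1 g) -es -(composeA g) -e -!composeA -wrapm_comp et wrapm_one compose1m.
Qed.

(** A top-level generator of the target is one of the source, and it may be
    pulled out before applying [f]. *)
Lemma pull_nat A C (f : term A C) : forall q : root C, factors (pull q ∘ f).
Proof.
elim: {A C} f.
- by move=> A q; apply: (factors_eq _ (factors_pull q)); rewrite composem1.
- move=> A B C [q|[q|q]].
  + exact: (@Factors (A ⊗ B ⊗ C) (inl (inl q)) _ _ _ (term_eq_sym (pull_assocL B C q))).
  + exact: (@Factors (A ⊗ B ⊗ C) (inl (inr q)) _ _ _ (term_eq_sym (pull_assocM A C q))).
  + exact: (@Factors (A ⊗ B ⊗ C) (inr q) _ _ _ (term_eq_sym (pull_assocR A B q))).
- move=> A B C [[q|q]|q].
  + exact: (factors_inv (assocVK _ _ _) (assocK _ _ _) (pull_assocL B C q)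
      (factors_pull (inl q : root (A ⊗ (B ⊗ C))))).
  + exact: (factors_inv (assocVK _ _ _) (assocK _ _ _) (pull_assocM A C q)
      (factors_pull (inr (inl q) : root (A ⊗ (B ⊗ C))))).
  + exact: (factors_inv (assocVK _ _ _) (assocK _ _ _) (pull_assocR A B q)
      (factors_pull (inr (inr q) : root (A ⊗ (B ⊗ C))))).
- by move=> A q; apply: (@Factors (I ⊗ A) (inr q) _ (lunit _)); rewrite pull_lunit.
- by move=> A [//|q]; exact: (factors_inv (lunitVK A) (lunitK _) (pull_lunit q) (factors_pull q)).
- by move=> A q; apply: (@Factors (A ⊗ I) (inl q) _ (runit _)); rewrite pull_runit.
- by move=> A [q|//]; exact: (factors_inv (runitVK A) (runitK _) (pull_runit q) (factors_pull q)).
- move=> A B [q|q].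
  + exact: (@Factors (A ⊗ B) (inr q) _ _ _ (term_eq_sym (pull_braidR A q))).
  + exact: (@Factors (A ⊗ B) (inl q) _ _ _ (term_eq_sym (pull_braidL B q))).
- move=> i A B []; apply: (@Factors (Endo i A ⊗ B) (inl tt) _ (one _)) => /=.
  by rewrite compose1m endo_one compose1m tens_one composem1.
- move=> i A B []; apply: (@Factors (A ⊗ Endo i B) (inr tt) _ (one _)) => /=.
  by rewrite compose1m endo_one compose1m tens_one composem1.
- move=> A B C g hg f hf q; apply: factors_eq (composeA _ _ _) _.
  exact: factors_comp.
- move=> A B C D f hf g hg [q|q] /=.
  + apply: (factors_eq _ (factors_tauL g (hf q))).
    by rewrite composeA -tens_comp compose1m.
  + apply: (factors_eq _ (factors_tauR f (hg q))).
    by rewrite composeA -tens_comp compose1m.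
- move=> i A B f _ []; apply: (@Factors (Endo i A) tt _ f) => /=.
  by rewrite compose1m composem1.
Qed.

End Roots.

#[local] Existing Instance wrapm_proper.

(** * Objects without generators *)

Section Unital.

Variables Letter Idx : Type.
Local Notation formula := (formula Letter Idx).
Implicit Types A B C : formula.

(** [unital A] is inhabited, by exactly one element, when [A] is a tensor of
    copies of [I]. *)
Fixpoint unital A : Type :=
  match A with
  | Unit => unit
  | A ⊗ B => (unital A * unital B)%type
  | _ => void
  end.

Fixpoint collapse A : unital A -> term A I :=
  match A with
  | Unit => fun _ => one I
  | A ⊗ B => fun t => lunit I ∘ (collapse t.1 ⊠ collapse t.2)
  | Atom _ => fun t => match t with end
  | Endo _ _ => fun t => match t with end
  end.

Lemma unital_irrelevance A (s t : unital A) : s = t.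
Proof.
elim: A s t => [x []|[] []|A hA B hB [a b] [a' b']|i A _ []] //.
by rewrite (hA a a') (hB b b').
Qed.

Fixpoint root_or_unital A : root A + unital A :=
  match A with
  | Atom _ => inl tt
  | Unit => inr tt
  | A ⊗ B => match root_or_unital A, root_or_unital B with
             | inl p, _ => inl (inl p)
             | _, inl p => inl (inr p)
             | inr s, inr t => inr (s, t)
             end
  | Endo _ _ => inl tt
  end.

Lemma collapse_assoc A B C (s : unital A) (t : unital B) (u : unital C) :
  collapse ((s, (t, u)) : unital (A ⊗ (B ⊗ C))) ∘ assoc A B C
  ≡ collapse (((s, t), u) : unital (A ⊗ B ⊗ C)).
Proof.
rewrite /= -[X in X ⊠ (_ ∘ _)]compose1m tens_comp !composeA -assoc_nat.
rewrite -(composeA (_ ⊠ lunit _)) triangle -lunit_runit_unit.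
by rewrite -tens_comp compose1m.
Qed.

(** Naturality of [collapse]. The source is unital as well, because arrows neither
    create nor destroy generators. *)
Lemma collapse_nat A C (f : term A C) :
  forall t : unital C, exists s : unital A, collapse t ∘ f ≡ collapse s.
Proof.
elim: {A C} f.
- by move=> A t; exists t; rewrite composem1.
- by move=> A B C [s [t u]]; exists ((s, t), u); exact: collapse_assoc.
- move=> A B C [[s t] u]; exists (s, (t, u)).
  by rewrite -collapse_assoc composeA assocVK composem1.
- by move=> A t; exists (tt, t); rewrite /= lunit_nat.
- by move=> A [[] t]; exists t; rewrite /= lunit_nat composeA lunitVK composem1.
- by move=> A t; exists (t, tt); rewrite /= lunit_runit_unit runit_nat.
- move=> A [t []]; exists t.
  by rewrite /= lunit_runit_unit runit_nat composeA runitVK composem1.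
- move=> A B [t s]; exists (s, t).
  by rewrite /= composeA -braid_nat -composeA lunit_braid lunit_runit_unit.
- by move=> i A B [].
- by move=> i A B [].
- move=> A B C g hg f hf u; have [t et] := hg u; have [s es] := hf t.
  by exists s; rewrite -composeA et.
- move=> A B C D f hf g hg [t u]; have [s es] := hf t; have [v ev] := hg u.
  by exists (s, v); rewrite /= composeA -tens_comp es ev.
- by move=> i A B f _ [].
Qed.

Lemma collapse_split C (t : unital C) : exists r, r ∘ collapse t ≡ one C.
Proof.
elim: C t => [x []|[]|A hA B hB [s t]|i A _ []] //=.
  by exists (one _); rewrite compose1m.
have [r er] := hA s; have [q eq] := hB t.
exists ((r ⊠ q) ∘ lunit_inv I); rewrite composeA (comp_cancel _ (lunitK _)).
by rewrite -tens_comp er eq tens_one.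
Qed.

(** Composing with the split mono [collapse t] turns both arrows into the only
    collapse of [A]. *)
Lemma unital_unique A C (t : unital C) (f g : term A C) : f ≡ g.
Proof.
have [r er] := collapse_split t; apply: (split_mono_cancel er).
have [s es] := collapse_nat f t; have [s' es'] := collapse_nat g t.
by rewrite es es' (unital_irrelevance s s').
Qed.

End Unital.

(** * Reading the pulled generator off the underlying function *)

Section Positions.

(** [funE] evaluates the cast of [(m + n) + p] to [m + (n + p)] on each summand;
    this and the next two lemmas do the same for the inverse cast. *)
Lemma fun_castL m n p (e : m + (n + p) = m + n + p) i :
  fun_cast e (lshift (n + p) i) = lshift p (lshift n i).
Proof. by rewrite ffunE; apply: val_inj. Qed.

Lemma fun_castM m n p (e : m + (n + p) = m + n + p) i :
  fun_cast e (rshift m (lshift p i)) = lshift p (rshift m i).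
Proof. by rewrite ffunE; apply: val_inj. Qed.

Lemma fun_castR m n p (e : m + (n + p) = m + n + p) i :
  fun_cast e (rshift m (rshift n i)) = rshift (m + n) i.
Proof. by rewrite ffunE; apply: val_inj => /=; rewrite addnA. Qed.

Lemma ord_split m n (P : 'I_(m + n) -> Prop) :
  (forall i, P (lshift n i)) -> (forall i, P (rshift m i)) -> forall i, P i.
Proof. by move=> hl hr i; case: (split_ordP i) => j ->. Qed.

Definition positionE := (funE, fun_castL, fun_castM, fun_castR).

Lemma fun_cast_inj m n (e : m = n) : injective (fun_cast e).
Proof. by move=> i j; rewrite !ffunE; apply: cast_ord_inj. Qed.

Lemma injective_fun_sum m n p q (f : {ffun 'I_m -> 'I_n}) (g : {ffun 'I_p -> 'I_q}) :
  injective f -> injective g -> injective (fun_sum f g).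
Proof.
move=> hf hg i j; case: (split_ordP i) => {}i ->; case: (split_ordP j) => {}j ->.
all: rewrite !funE => /eqP; rewrite ?eq_shift // => /eqP.
  by move/hf ->.
by move/hg ->.
Qed.

Lemma fun_sum_inj m n p q (f f' : {ffun 'I_m -> 'I_n}) (g g' : {ffun 'I_p -> 'I_q}) :
  fun_sum f g = fun_sum f' g' -> f = f' /\ g = g'.
Proof.
move=> /ffunP e; split; apply/ffunP => k.
  by have := e (lshift p k); rewrite !funE; apply: lshift_inj.
by have := e (rshift m k); rewrite !funE; apply: rshift_inj.
Qed.

Lemma fun_swap_inj m n : injective (fun_swap m n).
Proof.
by apply: (can_inj (g := fun_swap n m)) => i; case: (split_ordP i) => {}i ->; rewrite !funE.
Qed.

Lemma fun_psiR_inj m n : injective (fun_psiR m n).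
Proof.
have e : fun_psiR m n = fun_cmp (fun_cast (esym (addnA 1 m n)))
  (fun_cmp (fun_sum (fun_swap m 1) (fun_id n)) (fun_cast (addnA m 1 n))).
  apply/ffunP => i; case: (split_ordP i) => {}i ->; first by rewrite !positionE.
  by case: (split_ordP i) => {}i ->; rewrite !positionE.
have h : injective (fun_sum (fun_swap m 1) (fun_id n)).
  by apply: injective_fun_sum; [exact: fun_swap_inj | move=> i j; rewrite !funE].
by move=> i j; rewrite e !funE => /fun_cast_inj /h /fun_cast_inj.
Qed.

Variables Letter Idx : Type.
Local Notation formula := (formula Letter Idx).
Implicit Types A B C : formula.

Lemma Gterm_inj A B (f : term A B) : injective (Gterm f).
Proof.
elim: f => /= *; do ?exact: fun_cast_inj.
- by move=> i j; rewrite !funE.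
- exact: fun_swap_inj.
- exact: fun_psiR_inj.
- by move=> i j; rewrite !funE; auto.
- exact: injective_fun_sum.
- by apply: injective_fun_sum => // i j; rewrite !funE.
Qed.

Lemma Gob_eq A B (f : term A B) : Gob A = Gob B.
Proof. elim: f => //= *; lia. Qed.

Lemma Gterm_surj A B (f : term A B) k : exists i, Gterm f i = k.
Proof.
have [|g _ fK] := inj_card_bij (@Gterm_inj _ _ f); first by rewrite !card_ord (Gob_eq f).
by exists (g k); rewrite fK.
Qed.

Fixpoint pos A : root A -> 'I_(Gob A) :=
  match A return root A -> 'I_(Gob A) with
  | Atom _ => fun _ => ord0
  | Unit => fun p => match p with end
  | A ⊗ B => fun p => match p with
                      | inl p => lshift (Gob B) (pos p)
                      | inr p => rshift (Gob A) (pos p)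
                      end
  | Endo _ A => fun _ => lshift (Gob A) ord0
  end.

Lemma pos_inj A : injective (@pos A).
Proof.
elim: A => [x []|[]|A hA B hB|i A _ []] [] //.
- move=> p [] q /= /eqP; rewrite eq_shift // => /eqP e.
  by rewrite (hA _ _ e).
- move=> p [] q /= /eqP; rewrite eq_shift // => /eqP e.
  by rewrite (hB _ _ e).
Qed.

Lemma Gob_wrap o A : Gob (wrap o A : formula) = (Gob A).+1.
Proof. by case: o. Qed.

(** The position of the generator [o] itself in [wrap o A]. *)
Definition wrap_pos o A : 'I_(Gob (wrap o A)) :=
  match o return 'I_(Gob (wrap o A)) with
  | inl x => lshift (Gob A) ord0
  | inr i => lshift (Gob A) ord0
  end.

Lemma Gterm_shuffle A X B : Gterm (shuffle A X B : term _ (X ⊗ (A ⊗ B))) =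
  fun_cmp (fun_cmp (fun_cast (esym (addnA (Gob X) (Gob A) (Gob B))))
      (fun_sum (fun_swap (Gob A) (Gob X)) (fun_id (Gob B))))
    (fun_cast (addnA (Gob A) (Gob X) (Gob B))).
Proof. by rewrite shuffleE. Qed.

Lemma Gterm_tauL o A B : Gterm (tauL o A B) (lshift (Gob B) (wrap_pos o A)) = wrap_pos o (A ⊗ B).
Proof. by case: o => [x|i] /=; rewrite !funE. Qed.

Lemma Gterm_tauR o A B : Gterm (tauR o A B) (rshift (Gob A) (wrap_pos o B)) = wrap_pos o (A ⊗ B).
Proof. by case: o => [x|i] /=; rewrite ?Gterm_shuffle !positionE; exact: val_inj. Qed.

Lemma Gterm_pull A (p : root A) : Gterm (pull p) (pos p) = wrap_pos (label p) (rest p).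
Proof.
elim: A p => [x []|[]|A hA B hB [p|p]|i A _ []] /=.
- by apply: val_inj; rewrite ffunE.
- by rewrite !funE hA Gterm_tauL.
- by rewrite !funE hB Gterm_tauR.
- by rewrite !funE.
Qed.

Lemma Gterm_wrapm_pos o A B (f : term A B) : Gterm (wrapm o f) (wrap_pos o A) = wrap_pos o B.
Proof. by case: o => [x|i] /=; rewrite !funE. Qed.

Lemma Gterm_wrapm_inj o A B (f g : term A B) :
  Gterm (wrapm o f) = Gterm (wrapm o g) -> Gterm f = Gterm g.
Proof. by case: o => [x|i] /= /fun_sum_inj []. Qed.

(** Underlying functions are surjective. *)
Lemma Gterm_epi A B C (f : term A B) (g h : term B C) :
  Gterm (g ∘ f) = Gterm (h ∘ f) -> Gterm g = Gterm h.
Proof.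
move=> /ffunP e; apply/ffunP => k; have [i <-] := Gterm_surj f k.
by have := e i; rewrite /= !funE.
Qed.

(** The root through which [f] factors is the preimage of the leading position;
    this is what makes it determined by [Gterm f]. The label of that root is only
    provably equal to [o], hence the transport. *)
Lemma factors_pos A o B (f : term A (wrap o B)) : factors f ->
  exists2 p : root A, Gterm f (pos p) = wrap_pos o B
  & exists (e : label p = o) (k : term (rest p) B),
    f ≡ eq_rect _ (fun o => term A (wrap o B)) (wrapm (label p) k ∘ pull p) _ e.
Proof.
case=> p {}B k {}f e; exists p; last by exists erefl, k.
by rewrite (Gterm_eq e) /= funE Gterm_pull Gterm_wrapm_pos.
Qed.

(** Equal underlying functions give the same root, and then the same function
    for the remaining arrows. Two proofs that this root is labelled by [o] are
    identified by uniqueness of identity proofs: a nontrivial loop at a label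
    would give, by transport, an arrow that [G] cannot tell from the identity. *)
Lemma factors_unique A o B (f g : term A (wrap o B)) :
  factors f -> factors g -> Gterm f = Gterm g ->
  (forall A' (k l : term A' B), Gterm k = Gterm l -> k ≡ l) -> f ≡ g.
Proof.
move=> /factors_pos [p hp [e [k ef]]] /factors_pos [q hq [e' [l eg]]] efg inj.
have epq : p = q by apply: pos_inj; apply: (@Gterm_inj _ _ f); rewrite hp efg.
subst q; rewrite (UIP _ _ _ e' e) in eg.
move: (efg); rewrite (Gterm_eq ef) (Gterm_eq eg) ef eg.
case: _ / e {ef eg efg hp hq f g e'} => /= /Gterm_epi /Gterm_wrapm_inj /inj ekl.
by rewrite ekl.
Qed.

Lemma pull_unique A C (q : root C) (f g : term A C) : Gterm f = Gterm g ->
  (forall A' (k l : term A' (rest q)), Gterm k = Gterm l -> k ≡ l) ->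
  pull q ∘ f ≡ pull q ∘ g.
Proof. by move=> e; apply: factors_unique; rewrite /= ?e; do ?exact: pull_nat. Qed.

End Positions.

(** * Substitution of objects for letters *)

Section Substitution.

Variables (L J L' J' : Type) (s : L -> formula L' J') (h : J -> J').

Fixpoint subst (A : formula L J) : formula L' J' :=
  match A with
  | Atom x => s x
  | Unit => I
  | A ⊗ B => subst A ⊗ subst B
  | Endo i A => Endo (h i) (subst A)
  end.

Fixpoint substm A B (f : term A B) : term (subst A) (subst B) :=
  match f with
  | Defs.one A => one (subst A)
  | assoc A B C => assoc (subst A) (subst B) (subst C)
  | assoc_inv A B C => assoc_inv (subst A) (subst B) (subst C)
  | lunit A => lunit (subst A)
  | lunit_inv A => lunit_inv (subst A)
  | runit A => runit (subst A)
  | runit_inv A => runit_inv (subst A)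
  | braid A B => braid (subst A) (subst B)
  | psiL i A B => psiL (h i) (subst A) (subst B)
  | psiR i A B => psiR (h i) (subst A) (subst B)
  | g ∘ f => substm g ∘ substm f
  | f ⊠ g => substm f ⊠ substm g
  | endo i _ _ f => endo (h i) (substm f)
  end.

Lemma substm_eq A B (f g : term A B) : f ≡ g -> substm f ≡ substm g.
Proof.
elim=> {A B f g} /=; try by constructor.
by move=> A B f g k _ fg _; apply: term_eq_trans.
Qed.

Lemma substm_shuffle A X B :
  substm (shuffle A X B) = shuffle (subst A) (subst X) (subst B).
Proof. by rewrite !shuffleE. Qed.

End Substitution.

(** * Coherence for symmetric monoidal categories *)

Section SymmetricMonoidal.

Lemma Gob_root L J (A : formula L J) (p : root A) : Gob A = (Gob (rest p)).+1.
Proof. by rewrite (Gob_eq (pull p)) Gob_wrap. Qed.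

Variable L : Type.
Implicit Types A B C : formula L void.

Lemma tauL_split (o : generator L void) A B : exists r, r ∘ tauL o A B ≡ one (wrap o A ⊗ B).
Proof. by case: o => [x|[]]; exists (assoc_inv _ _ _); exact: assocK. Qed.

Lemma tauR_split (o : generator L void) A B : exists r, r ∘ tauR o A B ≡ one (A ⊗ wrap o B).
Proof.
case: o => [x|[]]; exists (assoc _ _ _ ∘ (braid _ _ ⊠ one _) ∘ assoc_inv _ _ _).
rewrite /= shuffleE !composeA (comp_cancel _ (assocK _ _ _)).
rewrite -(composeA (_ ⊠ one _)) tens_compL braidK tens_one compose1m.
exact: assocVK.
Qed.

(** Only tensoring with letters occurs in the absence of endofunctors, and the
    strengths of that functor are invertible. *)
Lemma pull_split C (q : root C) : exists r, r ∘ pull q ≡ one C.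
Proof.
elim: C q => [x []|[]|A hA B hB [q|q]|[] //] /=.
- by exists (runit _); rewrite runitVK.
- have [r er] := hA q; have [u eu] := tauL_split (label q) (rest q) B.
  by exists ((r ⊠ one B) ∘ u); rewrite composeA (comp_cancel _ eu) tens_compL er tens_one.
- have [r er] := hB q; have [u eu] := tauR_split (label q) A (rest q).
  by exists ((one A ⊠ r) ∘ u); rewrite composeA (comp_cancel _ eu) tens_compR er tens_one.
Qed.

(** Induction on the number of letters of the target: pull one of them out of
    both arrows; if there is none, the target is unital. *)
Lemma smc_faithful : faithful (G L void).
Proof.
move=> /= A C; have [n] := ubnP (Gob C); elim: n A C => // n IHn A C leCn f g e.
case: (root_or_unital C) => [q|t]; last exact: (unital_unique t).
have [r er] := pull_split q; apply: (split_mono_cancel er).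
apply: pull_unique => // A' k l; apply: IHn.
by rewrite (Gob_root q) in leCn.
Qed.

End SymmetricMonoidal.

(** An equation between structural arrows on arbitrary objects holds as soon as it
    holds between underlying functions when the objects are distinct letters. *)
Lemma smc_coherence L J (s : seq (formula L J)) (A B : formula nat void)
    (f g : term A B) :
  Gterm f = Gterm g ->
  substm (nth I s) (@of_void J) f ≡ substm (nth I s) (@of_void J) g.
Proof. by move=> e; apply/substm_eq/smc_faithful. Qed.

(** * The exchange of the inner factors of a tensor of tensors *)

Definition fun_exchange (m n p q : nat) :
    {ffun 'I_(m + n + (p + q)) -> 'I_(m + p + (n + q))} :=
  fun_cmp (fun_cmp (fun_cast (addnA m p (n + q)))
    (fun_sum (fun_id m) (fun_cmp (fun_cmp (fun_cast (esym (addnA p n q)))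
      (fun_sum (fun_swap n p) (fun_id q))) (fun_cast (addnA n p q)))))
    (fun_cast (esym (addnA m n (p + q)))).

Lemma fun_exchangeLL m n p q i :
  fun_exchange m n p q (lshift (p + q) (lshift n i)) = lshift (n + q) (lshift p i).
Proof. by rewrite !positionE. Qed.

Lemma fun_exchangeLR m n p q i :
  fun_exchange m n p q (lshift (p + q) (rshift m i)) = rshift (m + p) (lshift q i).
Proof. by rewrite !positionE. Qed.

Lemma fun_exchangeRL m n p q i :
  fun_exchange m n p q (rshift (m + n) (lshift q i)) = lshift (n + q) (rshift m i).
Proof. by rewrite !positionE. Qed.

Lemma fun_exchangeRR m n p q i :
  fun_exchange m n p q (rshift (m + n) (rshift p i)) = rshift (m + p) (rshift n i).
Proof. by rewrite !positionE. Qed.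

Definition fun_exchangeE :=
  (fun_exchangeLL, fun_exchangeLR, fun_exchangeRL, fun_exchangeRR).

Section Exchange.

Variables Letter Idx : Type.
Local Notation formula := (formula Letter Idx).
Implicit Types A B C D : formula.

(** Locked for the same reason as [shuffle]. *)
Definition exchange A B C D : term ((A ⊗ B) ⊗ (C ⊗ D)) ((A ⊗ C) ⊗ (B ⊗ D)) :=
  locked (assoc_inv A C (B ⊗ D) ∘ (one A ⊠ shuffle B C D) ∘ assoc A B (C ⊗ D)).

Lemma exchangeE A B C D : exchange A B C D =
  assoc_inv A C (B ⊗ D) ∘ (one A ⊠ shuffle B C D) ∘ assoc A B (C ⊗ D).
Proof. by rewrite /exchange -lock. Qed.

Lemma exchange_nat A A' B B' C C' D D'
    (f : term A A') (g : term B B') (h : term C C') (k : term D D') :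
  exchange A' B' C' D' ∘ ((f ⊠ g) ⊠ (h ⊠ k))
  ≡ ((f ⊠ h) ⊠ (g ⊠ k)) ∘ exchange A B C D.
Proof.
rewrite !exchangeE !composeA assoc_nat -(composeA (one A' ⊠ _)) -tens_comp.
rewrite shuffle_nat compose1m -[X in X ⊠ _]composem1 tens_comp -!composeA.
by rewrite assoc_inv_nat.
Qed.

Lemma Gterm_exchange A B C D :
  Gterm (exchange A B C D) = fun_exchange (Gob A) (Gob B) (Gob C) (Gob D).
Proof. by rewrite exchangeE /= Gterm_shuffle. Qed.

End Exchange.

Lemma substm_exchange L J L' J' (s : L -> formula L' J') (h : J -> J') A B C D :
  substm s h (exchange A B C D)
  = exchange (subst s h A) (subst s h B) (subst s h C) (subst s h D).
Proof. by rewrite !exchangeE /= substm_shuffle. Qed.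

Section ExchangeCoherence.

Variables Letter Idx : Type.
Local Notation formula := (formula Letter Idx).
Implicit Types A B C D : formula.

(** Compares two underlying functions on each summand of their domain; [case] is
    for the empty summands, which come from [I]. *)
Ltac by_positions := rewrite ?Gterm_exchange /=; apply/ffunP; do ?apply: ord_split;
  by [case | move=> ?; rewrite !(fun_exchangeE, positionE)].
Local Notation "# n" := (Atom void n) (at level 2).

Lemma exchange_assoc A A' B B' C C' :
  (assoc A B C ⊠ assoc A' B' C') ∘ exchange (A ⊗ B) (A' ⊗ B') C C'
    ∘ (exchange A A' B B' ⊠ one (C ⊗ C'))
  ≡ exchange A A' (B ⊗ C) (B' ⊗ C') ∘ (one (A ⊗ A') ⊠ exchange B B' C C')
    ∘ assoc (A ⊗ A') (B ⊗ B') (C ⊗ C').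
Proof.
have := @smc_coherence _ Idx [:: A; A'; B; B'; C; C'] _ _
 ((assoc #0 #2 #4 ⊠ assoc #1 #3 #5) ∘ exchange (#0 ⊗ #2) (#1 ⊗ #3) #4 #5
    ∘ (exchange #0 #1 #2 #3 ⊠ one (#4 ⊗ #5)))
 (exchange #0 #1 (#2 ⊗ #4) (#3 ⊗ #5) ∘ (one (#0 ⊗ #1) ⊠ exchange #2 #3 #4 #5)
    ∘ assoc (#0 ⊗ #1) (#2 ⊗ #3) (#4 ⊗ #5)).
by rewrite /= !substm_exchange; apply; by_positions.
Qed.

Lemma exchange_lunit A B :
  (lunit A ⊠ lunit B) ∘ exchange I I A B ≡ lunit (A ⊗ B) ∘ (lunit I ⊠ one (A ⊗ B)).
Proof.
have := @smc_coherence _ Idx [:: A; B] _ _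
  ((lunit #0 ⊠ lunit #1) ∘ exchange I I #0 #1)
  (lunit (#0 ⊗ #1) ∘ (lunit I ⊠ one (#0 ⊗ #1))).
by rewrite /= !substm_exchange; apply; by_positions.
Qed.

Lemma exchange_runit A B :
  (runit A ⊠ runit B) ∘ exchange A B I I ≡ runit (A ⊗ B) ∘ (one (A ⊗ B) ⊠ runit I).
Proof.
have := @smc_coherence _ Idx [:: A; B] _ _
  ((runit #0 ⊠ runit #1) ∘ exchange #0 #1 I I)
  (runit (#0 ⊗ #1) ∘ (one (#0 ⊗ #1) ⊠ runit I)).
by rewrite /= !substm_exchange; apply; by_positions.
Qed.

Lemma exchange_braid A B C D :
  (braid A C ⊠ braid B D) ∘ exchange A B C D
  ≡ exchange C D A B ∘ braid (A ⊗ B) (C ⊗ D).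
Proof.
have := @smc_coherence _ Idx [:: A; B; C; D] _ _
  ((braid #0 #2 ⊠ braid #1 #3) ∘ exchange #0 #1 #2 #3)
  (exchange #2 #3 #0 #1 ∘ braid (#0 ⊗ #1) (#2 ⊗ #3)).
by rewrite /= !substm_exchange; apply; by_positions.
Qed.

(** Stated with inverse units, as it is used for [separates_runit]; the proof
    first moves them to the other side, to compare functions without inverse
    units. The next two lemmas are treated alike. *)
Lemma exchange_runits A B :
  (one (A ⊗ B) ⊠ runit I) ∘ exchange A I B I ∘ (runit_inv A ⊠ runit_inv B)
  ≡ runit_inv (A ⊗ B).
Proof.
apply: (split_mono_cancel (runitK _)); rewrite runitVK -!composeA.
apply: (split_epi_cancel (f := runit A ⊠ runit B) (f' := runit_inv A ⊠ runit_inv B)).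
  by rewrite -tens_comp !runitVK tens_one.
rewrite compose1m !composeA -(tens_comp (runit_inv _)) !runitK tens_one composem1.
rewrite -composeA.
have := @smc_coherence _ Idx [:: A; B] _ _
  (runit (#0 ⊗ #1) ∘ (one (#0 ⊗ #1) ⊠ runit I) ∘ exchange #0 I #1 I)
  (runit #0 ⊠ runit #1).
by rewrite /= !substm_exchange; apply; by_positions.
Qed.

Lemma exchange_lunits A B :
  (lunit I ⊠ one (A ⊗ B)) ∘ exchange I A I B ∘ (lunit_inv A ⊠ lunit_inv B)
  ≡ lunit_inv (A ⊗ B).
Proof.
apply: (split_mono_cancel (lunitK _)); rewrite lunitVK -!composeA.
apply: (split_epi_cancel (f := lunit A ⊠ lunit B) (f' := lunit_inv A ⊠ lunit_inv B)).
  by rewrite -tens_comp !lunitVK tens_one.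
rewrite compose1m !composeA -(tens_comp (lunit_inv _)) !lunitK tens_one composem1.
rewrite -composeA.
have := @smc_coherence _ Idx [:: A; B] _ _
  (lunit (#0 ⊗ #1) ∘ (lunit I ⊠ one (#0 ⊗ #1)) ∘ exchange I #0 I #1)
  (lunit #0 ⊠ lunit #1).
by rewrite /= !substm_exchange; apply; by_positions.
Qed.

Lemma exchange_units A B :
  (runit A ⊠ lunit B) ∘ exchange A I I B ∘ (runit_inv A ⊠ lunit_inv B) ≡ one (A ⊗ B).
Proof.
apply: (split_epi_cancel (f := runit A ⊠ lunit B) (f' := runit_inv A ⊠ lunit_inv B)).
  by rewrite -tens_comp runitVK lunitVK tens_one.
rewrite compose1m !composeA -(tens_comp (runit_inv _)) runitK lunitK tens_one composem1.
have := @smc_coherence _ Idx [:: A; B] _ _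
  ((runit #0 ⊠ lunit #1) ∘ exchange #0 I I #1) (runit #0 ⊠ lunit #1).
by rewrite /= !substm_exchange; apply; by_positions.
Qed.

End ExchangeCoherence.

(** * Separating the top-level generators into two groups *)

Section Cuts.

Variables Letter Idx : Type.
Local Notation formula := (formula Letter Idx).
Implicit Types A B C D X Y : formula.

(** A cut tells for each top-level generator whether it goes to the left or to the
    right; [true] means left. *)
Fixpoint cut A : Type :=
  match A with
  | Atom _ => bool
  | Unit => unit
  | A ⊗ B => (cut A * cut B)%type
  | Endo _ _ => bool
  end.

Fixpoint lpart A : cut A -> formula :=
  match A with
  | Unit => fun _ => I
  | A ⊗ B => fun s => lpart s.1 ⊗ lpart s.2
  | A => fun b => if b then A else I
  end.

Fixpoint rpart A : cut A -> formula :=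
  match A with
  | Unit => fun _ => I
  | A ⊗ B => fun s => rpart s.1 ⊗ rpart s.2
  | A => fun b => if b then I else A
  end.

Definition cutm1 A (b : bool) : term A ((if b then A else I) ⊗ (if b then I else A)) :=
  match b with true => runit_inv A | false => lunit_inv A end.

Fixpoint cutm A : forall s : cut A, term A (lpart s ⊗ rpart s) :=
  match A with
  | Atom x => cutm1 (Atom Idx x)
  | Unit => fun _ => runit_inv I
  | A ⊗ B => fun s => exchange _ _ _ _ ∘ (cutm s.1 ⊠ cutm s.2)
  | Endo i A => cutm1 (Endo i A)
  end.

Definition separates A X Y (h : term A (X ⊗ Y)) : Prop :=
  exists (s : cut A) (f : term (lpart s) X) (g : term (rpart s) Y), h ≡ (f ⊠ g) ∘ cutm s.

Lemma separates_eq A X Y (h k : term A (X ⊗ Y)) : h ≡ k -> separates h -> separates k.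
Proof. by move=> e [s [f [g es]]]; exists s, f, g; rewrite -e. Qed.

Lemma separates_tens A X Y X' Y' (h : term A (X ⊗ Y)) (f : term X X') (g : term Y Y') :
  separates h -> separates ((f ⊠ g) ∘ h).
Proof.
move=> [s [f' [g' e]]]; exists s, (f ∘ f'), (g ∘ g').
by rewrite e -composeA -tens_comp.
Qed.

Lemma separates_cutm A (s : cut A) : separates (cutm s).
Proof. by exists s, (one _), (one _); rewrite tens_one compose1m. Qed.

Lemma separates_comp A B X Y (h : term B (X ⊗ Y)) (f : term A B) :
  separates h -> (forall s : cut B, separates (cutm s ∘ f)) -> separates (h ∘ f).
Proof.
move=> [s [f' [g' e]]] hf; apply: (@separates_eq _ _ _ ((f' ⊠ g') ∘ (cutm s ∘ f))).
  by rewrite e composeA.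
exact/separates_tens/hf.
Qed.

Lemma separates_exchange A X Y A' X' Y' (h : term A (X ⊗ Y)) (h' : term A' (X' ⊗ Y')) :
  separates h -> separates h' -> separates (exchange X Y X' Y' ∘ (h ⊠ h')).
Proof.
move=> [s [f [g e]]] [s' [f' [g' e']]].
exists ((s, s') : cut (A ⊗ A')), (f ⊠ f'), (g ⊠ g') => /=.
by rewrite e e' tens_comp -!composeA exchange_nat.
Qed.

Lemma separates_runit A : separates (runit_inv A).
Proof.
elim: A => [x||A hA B hB|i A _].
- by exists (true : cut (Atom Idx x)), (one _), (one _); rewrite tens_one compose1m.
- by exists (tt : cut I), (one _), (one _); rewrite tens_one compose1m.
- apply: separates_eq (exchange_runits A B) _.
  apply: separates_eq (term_eq_sym (composeA _ _ _)) _.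
  exact/separates_tens/separates_exchange.
- by exists (true : cut (Endo i A)), (one _), (one _); rewrite tens_one compose1m.
Qed.

Lemma separates_lunit A : separates (lunit_inv A).
Proof.
elim: A => [x||A hA B hB|i A _].
- by exists (false : cut (Atom Idx x)), (one _), (one _); rewrite tens_one compose1m.
- exists (tt : cut I), (one _), (one _); rewrite tens_one compose1m /=.
  by apply: (split_mono_cancel (lunitK _)); rewrite lunitVK lunit_runit_unit runitVK.
- apply: separates_eq (exchange_lunits A B) _.
  apply: separates_eq (term_eq_sym (composeA _ _ _)) _.
  exact/separates_tens/separates_exchange.
- by exists (false : cut (Endo i A)), (one _), (one _); rewrite tens_one compose1m.
Qed.

(** This settles the arrows whose target is a single tree: everything goes to the
    same side, and the other side is a tensor of copies of [I]. *)
Lemma separates_cutm1 A X b (f : term A X) : separates (cutm1 X b ∘ f).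
Proof.
case: b => /=.
  apply: (@separates_eq _ _ _ ((f ⊠ one I) ∘ runit_inv A));
    last exact/separates_tens/separates_runit.
  apply: (split_mono_cancel (runitK _)).
  by rewrite -!composeA runit_nat runitVK compose1m composeA runitVK composem1.
apply: (@separates_eq _ _ _ ((one I ⊠ f) ∘ lunit_inv A));
  last exact/separates_tens/separates_lunit.
apply: (split_mono_cancel (lunitK _)).
by rewrite -!composeA lunit_nat lunitVK compose1m composeA lunitVK composem1.
Qed.

(** Here the cut sends all of [X] to the left and all of [Y] to the right. *)
Lemma separates_one X Y : separates (one (X ⊗ Y)).
Proof.
apply: separates_eq (exchange_units X Y) _.
apply: separates_eq (term_eq_sym (composeA _ _ _)) _.
apply/separates_tens/separates_exchange; [exact: separates_runit | exact: separates_lunit].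
Qed.

Lemma cutm_assoc A B C (s : cut A) (t : cut B) (u : cut C) :
  (assoc _ _ _ ⊠ assoc _ _ _) ∘ cutm (((s, t), u) : cut (A ⊗ B ⊗ C))
  ≡ cutm ((s, (t, u)) : cut (A ⊗ (B ⊗ C))) ∘ assoc A B C.
Proof.
have e X Y X' Y' Z (h : term Y Z) (f : term X Y) (g : term X' Y') :
    (h ∘ f) ⊠ g ≡ (h ⊠ one Y') ∘ (f ⊠ g) by rewrite -tens_comp compose1m.
have e' X Y X' Y' Z (h : term Y Z) (f : term X Y) (g : term X' Y') :
    g ⊠ (h ∘ f) ≡ (one Y' ⊠ h) ∘ (g ⊠ f) by rewrite -tens_comp compose1m.
by rewrite /= e e' !composeA -assoc_nat -!composeA exchange_assoc.
Qed.

Lemma separates_inv A B X Y X' Y' (a : term A B) (a' : term B A)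
    (t : term X X') (t' : term X' X) (u : term Y Y') (u' : term Y' Y)
    (f : term A (X ⊗ Y)) (g : term B (X' ⊗ Y')) :
  a ∘ a' ≡ one B -> t' ∘ t ≡ one X -> u' ∘ u ≡ one Y -> (t ⊠ u) ∘ f ≡ g ∘ a ->
  separates g -> separates (f ∘ a').
Proof.
move=> ea et eu e hg; apply: (@separates_eq _ _ _ ((t' ⊠ u') ∘ g)).
  rewrite -(composem1 g) -ea -(composeA g) -e -!composeA -tens_comp et eu.
  by rewrite tens_one compose1m.
exact: separates_tens.
Qed.

Lemma cutm_lunit A (s : cut A) :
  (lunit _ ⊠ lunit _) ∘ cutm ((tt, s) : cut (I ⊗ A)) ≡ cutm s ∘ lunit A.
Proof.
rewrite /= -composeA exchange_lunit composeA -tens_comp compose1m.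
by rewrite lunit_runit_unit runitVK lunit_nat.
Qed.

Lemma cutm_runit A (s : cut A) :
  (runit _ ⊠ runit _) ∘ cutm ((s, tt) : cut (A ⊗ I)) ≡ cutm s ∘ runit A.
Proof.
rewrite /= -composeA exchange_runit composeA -tens_comp compose1m.
by rewrite runitVK runit_nat.
Qed.

Lemma cutm_braid A B (s : cut A) (t : cut B) :
  (braid _ _ ⊠ braid _ _) ∘ cutm ((s, t) : cut (A ⊗ B))
  ≡ cutm ((t, s) : cut (B ⊗ A)) ∘ braid A B.
Proof. by rewrite /= -composeA exchange_braid !composeA braid_nat. Qed.

(** Trees that end up in one tree of the target have to go to the same side, and
    any cut of the target induces one of the source. *)
Lemma cutm_nat A C (f : term A C) : forall s : cut C, separates (cutm s ∘ f).
Proof.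
elim: {A C} f.
- by move=> A s; apply: separates_eq (separates_cutm s); rewrite composem1.
- move=> A B C [s [t u]]; apply: separates_eq (cutm_assoc s t u) _.
  exact/separates_tens/separates_cutm.
- move=> A B C [[s t] u].
  apply: (separates_inv _ _ _ (cutm_assoc s t u)
    (separates_cutm ((s, (t, u)) : cut (A ⊗ (B ⊗ C)))));
    [exact: assocVK | exact: assocK | exact: assocK].
- move=> A s; apply: separates_eq (cutm_lunit s) _.
  exact/separates_tens/separates_cutm.
- move=> A [[] s].
  exact: (separates_inv (lunitVK _) (lunitK _) (lunitK _) (cutm_lunit s) (separates_cutm _)).
- move=> A s; apply: separates_eq (cutm_runit s) _.
  exact/separates_tens/separates_cutm.
- move=> A [s []].
  exact: (separates_inv (runitVK _) (runitK _) (runitK _) (cutm_runit s) (separates_cutm _)).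
- move=> A B [t s]; apply: separates_eq (cutm_braid s t) _.
  exact/separates_tens/separates_cutm.
- by move=> i A B s; exact: separates_cutm1.
- by move=> i A B s; exact: separates_cutm1.
- move=> A B C g hg f hf s; apply: separates_eq (composeA _ _ _) _.
  exact: separates_comp.
- move=> A B C D f hf g hg [s t] /=.
  apply: separates_eq (separates_exchange (hf s) (hg t)).
  by rewrite composeA -tens_comp.
- by move=> i A B f _ s; exact: separates_cutm1.
Qed.

(** Apply the naturality of [cutm] to the cut through which the identity of
    [X ⊗ Y] separates. *)
Lemma tens_separates A X Y (f : term A (X ⊗ Y)) : separates f.
Proof.
apply: (separates_eq (compose1m f)).
by apply: separates_comp; [exact: separates_one | exact: cutm_nat].
Qed.

(** A cut as a two-colouring of all positions: what is under an endofunctor goes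
    with it. *)
Fixpoint side A : cut A -> 'I_(Gob A) -> bool :=
  match A return cut A -> 'I_(Gob A) -> bool with
  | Atom _ => fun b _ => b
  | Unit => fun _ _ => true
  | A ⊗ B => fun s k => match fintype.split k with
                        | inl i => side s.1 i
                        | inr j => side s.2 j
                        end
  | Endo _ _ => fun b _ => b
  end.

Lemma side_inj A (s t : cut A) : side s =1 side t -> s = t.
Proof.
elim: A s t => [x b c e|[] []//|A hA B hB [s s'] [t t'] e|i A _ b c e].
- exact: (e ord0).
- congr pair; [apply: hA => k; have := e (lshift (Gob B) k)
              | apply: hB => k; have := e (rshift (Gob A) k)].
    by rewrite /= (unsplitK (inl k)).
  by rewrite /= (unsplitK (inr k)).
- exact: (e (lshift (Gob A) ord0)).
Qed.

Lemma fun_sum_side m n p q (f : {ffun 'I_m -> 'I_n}) (g : {ffun 'I_p -> 'I_q}) k :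
  (fun_sum f g k < n) = (k < m).
Proof. by case: (split_ordP k) => {}k ->; rewrite !funE /= ?ltn_ord // !ltnNge !leq_addr. Qed.

Lemma Gterm_cutm1 A b k : (Gterm (cutm1 A b) k < Gob (if b then A else I)) = b.
Proof. by case: b; rewrite /= ffunE /= ?ltn_ord. Qed.

Lemma Gterm_cutm A (s : cut A) k : (Gterm (cutm s) k < Gob (lpart s)) = side s k.
Proof.
elim: A s k => [x b|[] []//|A hA B hB [s t]|i A _ b] k; try exact: Gterm_cutm1.
have lt m n (i : 'I_m) : lshift n i < m by exact: (ltn_ord i).
have ge m n (i : 'I_n) : (rshift m i < m) = false by rewrite ltnNge leq_addr.
rewrite /= Gterm_exchange; case: (split_ordP k) => {}k ->; rewrite fun_cmpE.
- rewrite fun_sumL -hA.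
  by case: (split_ordP (Gterm (cutm s) k)) => j ->; rewrite fun_exchangeE ?lt ?ge.
- rewrite fun_sumR -hB.
  by case: (split_ordP (Gterm (cutm t) k)) => j ->; rewrite fun_exchangeE ?lt ?ge.
Qed.

(** A position goes to the left exactly when [Gterm f] sends it into [X], so the
    cut is determined by [Gterm f]. The functions of the two components are then
    determined because the one of [cutm] is surjective. *)
Lemma tens_unique A X Y (f g : term A (X ⊗ Y)) : Gterm f = Gterm g ->
  (forall A' (h k : term A' X), Gterm h = Gterm k -> h ≡ k) ->
  (forall A' (h k : term A' Y), Gterm h = Gterm k -> h ≡ k) -> f ≡ g.
Proof.
have [s [h [k ef]]] := tens_separates f; have [t [h' [k' eg]]] := tens_separates g.
move=> e uX uY.
have est : s = t.
  apply: side_inj => i; rewrite -!Gterm_cutm.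
  have := congr1 (fun u : {ffun 'I_(Gob A) -> 'I_(Gob (X ⊗ Y))} => u i < Gob X) e.
  by rewrite (Gterm_eq ef) (Gterm_eq eg) /= !funE !fun_sum_side.
subst t; move: e; rewrite (Gterm_eq ef) (Gterm_eq eg) => /Gterm_epi /= /fun_sum_inj [].
by rewrite ef eg => /uX -> /uY ->.
Qed.

End Cuts.

Theorem mainTheorem6 (Letter Idx : Type) : faithful (G Letter Idx).
Proof.
move=> A C /=; elim: C A => [x||C hC D hD|i C hC] A f g e.
(* Pulling the only root of a letter is the inverse right unit, and of
   [Endo i C] the identity. *)
- suff : pull (tt : root (Atom Idx x)) ∘ f ≡ pull (tt : root (Atom Idx x)) ∘ g.
    exact: (split_mono_cancel (runitVK _)).
  apply: pull_unique => // A' k l _; exact: (unital_unique (tt : unital I)).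
- exact: (unital_unique (tt : unital I)).
- exact: tens_unique.
- suff : pull (tt : root (Endo i C)) ∘ f ≡ pull (tt : root (Endo i C)) ∘ g.
    by rewrite /= !compose1m.
  by apply: pull_unique => // A'; exact: hC.
Qed.
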